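(* Let $\mathcal{I} = \{I_k\}_{k\in\mathbb{N}}$ be a graded family of $\mathfrak{m}$-primary homogeneous ideals in $R = \Bbbk[x_1,\dots,x_n]$, and let $v$ be a good valuation of $R$ that respects the monomials in $R$. Let $\mathcal{C}(\mathcal{I})$ and $\Delta(\mathcal{I})$ be the limiting and Newton-Okounkov bodies of $\mathcal{I}$ defined by $v$. Suppose that $\mathcal{C}(\mathcal{I})$ is a polyhedron. Then $$\ell^*(\mathcal{I}) = \mathrm{mdc}(\Delta(\mathcal{I})) + 1 = \dim R.$$
   Context: $\Bbbk$ is a field, $R = \Bbbk[x_1,\dots,x_n]$ with maximal homogeneous ideal $\mathfrak{m} = (x_1,\dots,x_n)$ and quotient field $K$; $\mathbb{N}$ denotes the positive integers. A collection $\mathcal{I} = \{I_k\}_{k\in\mathbb{N}}$ of ideals of $R$ is a graded family if $I_p I_q \subseteq I_{p+q}$ for all $p,q$. For an ideal $I$, $\mu(I)$ is its minimum number of generators, and $\ell^*(\mathcal{I}) = \min\{t \in \mathbb{R} : \mu(I_k) = O(k^{t-1})\}$ (as $k\to\infty$). Valuations. Equip $\mathbb{Z}^n$ with a total order compatible with addition. A valuation $v: K\setminus\{0\} \to \mathbb{Z}^n$ satisfies $v(fg) = v(f)+v(g)$, $v(f+g) \ge \min(v(f),v(g))$ when $f+g\neq 0$, and $v(cf) = v(f)$ for $c \in \Bbbk\setminus\{0\}$. It has one-dimensional leaves if whenever $v(f) = v(g)$ there is $c \in \Bbbk\setminus\{0\}$ with $f + cg = 0$ or $v(f+cg) > v(f)$.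 A valuation $v$ with one-dimensional leaves is good for $R$ if: (i) the value semigroup $S = v(R\setminus\{0\}) \cup \{0\}$ generates $\mathbb{Z}^n$ as a group, and the closed convex cone $C(S)$ it generates is strongly convex (contains no line); and (ii) there exist $r_0 > 0$ and a linear function $\lambda: \mathbb{R}^n \to \mathbb{R}$, nonnegative on $C(S)$ and vanishing on $C(S)$ only at the origin, such that for every $f \in R\setminus\{0\}$ and every integer $k>0$, if $\lambda(v(f)) \ge k r_0$ then $f \in \mathfrak{m}^k$. The valuation $v$ respects the monomials of $R$ if $v(x_1^{a_1}\cdots x_n^{a_n}) = (a_1,\dots,a_n)$ for every monomial; in this case the value semigroup is $S=\mathbb{Z}^n_{\ge 0}$. Bodies. Let $\mathrm{val}(I_k) = \{v(f) : f \in I_k\setminus\{0\}\}$. The limiting body with respect to $v$ is $\mathcal{C}(\mathcal{I}) = \bigcup_{k\in\mathbb{N}} \frac{1}{k}\,\mathrm{conv}(\mathrm{val}(I_k)) \subseteq \mathbb{R}^n$, where $\mathrm{conv}$ denotes convex hull, and the Newton-Okounkov body with respect to $v$ is its topological closure $\Delta(\mathcal{I}) = \overline{\mathcal{C}(\mathcal{I})}$. A polyhedron is an intersection of finitely many closed half-spaces; $\mathrm{mdc}(P)$ is the maximum dimension of a compact face of a polyhedron $P$. *)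

(* Defs.v *)
(* Import order matters: mpoly has to precede the MathComp-Analysis files,
   whose notations would otherwise conflict with it. *)
From HB Require Import structures.
From mathcomp Require Import all_boot all_order all_algebra fraction.
From mathcomp Require Import mpoly.
From mathcomp Require Import boolp classical_sets reals topology normedtype.
From mathcomp Require Import landau exp convex.
Import Order.TTheory GRing.Theory Num.Theory.
Import numFieldNormedType.Exports.

Set Implicit Arguments.
Unset Strict Implicit.
Unset Printing Implicit Defensive.

Local Open Scope classical_set_scope.
Local Open Scope ring_scope.

Section Ideals.
Context {A : comNzRingType}.
Implicit Types (I J P S : set A).

Definition is_ideal I : Prop :=
  [/\ I 0, (forall f g, I f -> I g -> I (f + g))
         & (forall a f, I f -> I (a * f))].

Definition ideal_gen S : set A := smallest is_ideal S.

Definition ideal_mul I J : set A :=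
  ideal_gen [set h | exists f g, [/\ I f, J g & h = f * g]].

Definition ideal_exp I (j : nat) : set A := iter j (ideal_mul I) setT.

Definition radical I : set A := [set f | exists j : nat, I (f ^+ j)].

Definition is_primary I : Prop :=
  [/\ is_ideal I, ~ I 1
    & forall f g, I (f * g) -> I f \/ exists j : nat, I (g ^+ j)].

Definition primary_to P I : Prop := is_primary I /\ radical I = P.

Definition is_prime P : Prop :=
  [/\ is_ideal P, ~ P 1 & forall f g, P (f * g) -> P f \/ P g].

Definition gen_by I (m : nat) : Prop :=
  exists f : 'I_m -> A, I = ideal_gen (range f).

(* The minimum number of generators; the default value 0 is taken only by
   sets that are not finitely generated ideals, hence by no ideal of a
   polynomial ring in finitely many variables over a field. *)
Definition mu I : nat :=
  xget 0%N [set m | gen_by I m /\ forall m', gen_by I m' -> (m <= m')%N].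

Definition prime_chain (d : nat) : Prop :=
  exists P : 'I_d.+1 -> set A,
    (forall i, is_prime (P i)) /\
    (forall i j : 'I_d.+1, (i < j)%N -> P i `<` P j).

(* Graded families are indexed by the positive integers: the value
   of [I] at 0 is never used. *)
Definition graded_family (I : nat -> set A) : Prop :=
  (forall j, (0 < j)%N -> is_ideal (I j)) /\
  (forall p q, (0 < p)%N -> (0 < q)%N -> ideal_mul (I p) (I q) `<=` I (p + q)%N).

End Ideals.

Definition krull_dim (A : comNzRingType) (d : nat) : Prop :=
  @prime_chain A d /\ forall e, @prime_chain A e -> (e <= d)%N.

Definition is_ell_star (R : realType) (A : comNzRingType)
    (I : nat -> set A) (t : R) : Prop :=
  let bounded (s : R) :=
    (fun j : nat => (mu (I j))%:R : R^o) =O_\oo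
    (fun j : nat => j%:R `^ (s - 1) : R^o) in
  bounded t /\ forall s, bounded s -> t <= s.

Section PolynomialRing.
Context (k : fieldType) (n : nat).

Definition max_homog_ideal : set {mpoly k[n]} :=
  ideal_gen (range (fun i : 'I_n => 'X_i : {mpoly k[n]})).

Definition homogeneous_ideal (I : set {mpoly k[n]}) : Prop :=
  exists S : set {mpoly k[n]},
    (forall f, S f -> f \is homog mdeg) /\ I = ideal_gen S.

End PolynomialRing.
Arguments max_homog_ideal : clear implicits.

Section Geometry.
Context {R : realType} {n : nat}.
Implicit Types (A C P F : set 'rV[R]_n) (a x y : 'rV[R]_n).

Definition dot a x : R := \sum_i a 0 i * x 0 i.

Definition convex_hull A : set 'rV[R]_n := smallest (fun C => convex_set C) A.

Definition convex_cone C : Prop :=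
  [/\ C 0, (forall x y, C x -> C y -> C (x + y))
         & (forall (t : R) x, 0 <= t -> C x -> C (t *: x))].

Definition closed_convex_cone_gen A : set 'rV[R]_n :=
  smallest (fun C => closed C /\ convex_cone C) A.

Definition contains_line C : Prop :=
  exists x a, a != 0 /\ forall t : R, C (x + t *: a).

Definition closed_half_space C : Prop :=
  exists a (b : R), a != 0 /\ C = [set x | b <= dot a x].

Definition polyhedron P : Prop :=
  exists (m : nat) (H : 'I_m -> set 'rV[R]_n),
    (forall i, closed_half_space (H i)) /\ P = \bigcap_i H i.

(* Taking a = 0 and b = 0 shows that P is a face of itself. *)
Definition is_face P F : Prop :=
  exists a (b : R), (forall x, P x -> b <= dot a x) /\
                    F = [set x | P x /\ dot a x = b].

Definition is_affine A : Prop :=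
  forall x y (t : R), A x -> A y -> A ((1 - t) *: x + t *: y).

(* The affine hull of F is a translate of a linear subspace of dimension d;
   in particular F is nonempty. *)
Definition has_dim F (d : nat) : Prop :=
  exists x0 (U : {vspace 'rV[R]_n}),
    \dim U = d /\ smallest is_affine F = [set x0 + u | u in [set` U]].

Definition is_mdc P (d : nat) : Prop :=
  (exists F, [/\ is_face P F, compact F & has_dim F d]) /\
  (forall F e, is_face P F -> compact F -> has_dim F e -> (e <= d)%N).

End Geometry.

Definition group_total_order (G : zmodType) (le : rel G) : Prop :=
  [/\ reflexive le, antisymmetric le, transitive le, total le
    & forall a b c, le a b -> le (a + c) (b + c)].

Definition is_subgroup (G : zmodType) (H : set G) : Prop :=
  H 0 /\ forall a b, H a -> H b -> H (a - b).

Section Valuations.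
Context {k : fieldType} {n : nat}.
Local Notation A := {mpoly k[n]}.
Local Notation K := {fraction {mpoly k[n]}}.
Local Notation "x %:F" := (tofrac x).
Context (R : realType) (le : rel 'rV[int]_n) (v : K -> 'rV[int]_n).

(* The value of [v] at 0 is irrelevant here and in all that follows. *)
Definition is_valuation : Prop :=
  [/\ forall f g : K, f != 0 -> g != 0 -> v (f * g) = v f + v g,
      forall f g : K, f != 0 -> g != 0 -> f + g != 0 ->
        le (if le (v f) (v g) then v f else v g) (v (f + g))
    & forall (c : k) (f : K), c != 0 -> f != 0 -> v ((c%:MP : A)%:F * f) = v f].

Definition one_dimensional_leaves : Prop :=
  forall f g : K, f != 0 -> g != 0 -> v f = v g ->
    exists c : k, c != 0 /\
      let h := f + (c%:MP : A)%:F * g in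
      h = 0 \/ (le (v f) (v h) /\ v h != v f).

Definition value_semigroup : set 'rV[int]_n :=
  [set v f%:F | f in [set f : A | f != 0]] `|` [set 0].

Definition toR (u : 'rV[int]_n) : 'rV[R]_n := map_mx intr u.

Definition value_cone : set 'rV[R]_n :=
  closed_convex_cone_gen (toR @` value_semigroup).

Definition good_valuation : Prop :=
  [/\ is_valuation, one_dimensional_leaves,
      smallest (@is_subgroup _) value_semigroup = setT,
      ~ contains_line value_cone
    & exists (r0 : R) (lambda : {scalar 'rV[R]_n}),
        [/\ 0 < r0,
            forall x, value_cone x -> 0 <= lambda x,
            forall x, value_cone x -> lambda x = 0 -> x = 0
          & forall (f : A) (j : nat), f != 0 -> (0 < j)%N ->
              j%:R * r0 <= lambda (toR (v f%:F)) ->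
              ideal_exp (max_homog_ideal k n) j f]].

Definition respects_monomials : Prop :=
  forall m : 'X_{1..n}, v ('X_[m] : A)%:F = \row_i (m i)%:Z.

Definition val_ideal (I : set A) : set 'rV[int]_n :=
  [set v f%:F | f in [set f | I f /\ f != 0]].

Definition limiting_body (I : nat -> set A) : set 'rV[R]_n :=
  \bigcup_(j in [set j | (0 < j)%N])
    [set (j%:R)^-1 *: x | x in convex_hull (toR @` val_ideal (I j))].

Definition NO_body (I : nat -> set A) : set 'rV[R]_n :=
  closure (limiting_body I).

End Valuations.
Arguments good_valuation {k n} R le v.
Arguments limiting_body {k n} R v I.
Arguments NO_body {k n} R v I.

(* Main.v *)
Require Import Defs.
From HB Require Import structures.
From mathcomp Require Import all_boot all_order all_algebra fraction.
From mathcomp Require Import mpoly.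
From mathcomp Require Import boolp classical_sets reals topology normedtype.
From mathcomp Require Import landau exp convex interval_inference.
Import Order.TTheory GRing.Theory Num.Theory.
Import numFieldNormedType.Exports.
Local Open Scope classical_set_scope.
Local Open Scope ring_scope.

(** For a valuation respecting the monomials, v(f) is always an exponent of f.

Upper bound for mu: I_k contains the powers x_i^(N k), so a Groebner-type
argument generates I_k by these and one element for each choice of the first
n - 1 exponents below N k; this gives O(k^(n-1)).

Lower bound for mu: since R / I_1 is finite-dimensional and I_1 I_m is
contained in I_(m+1), dim R / I_M <= dim (R / I_1) (1 + sum_(m < M) mu(I_m));
on the other hand the limiting body is closed and misses 0, so I_M has no
value in a box of side c M, whence dim R / I_M >= (c M)^n.

Compact facet: the limiting body is unbounded along each coordinate axis, so
its half-spaces b <= a.x have a >= 0, with a > 0 as soon as b > 0. Along a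
generic positive ray exactly one such half-space is tight at the entry point,
and its face is compact of dimension n - 1. A compact face of dimension n would
be the whole body.

Krull dimension: any n + 1 polynomials are algebraically dependent over the
field, by counting monomials, whereas elements f_i of P_i \ P_(i-1) along a
chain of primes satisfy no algebraic relation. *)

(** * Ideals, finite generating families and [mu] *)

Section IdealGeneralities.
Context {A : comNzRingType}.
Implicit Types (I J P S : set A).

Lemma ideal_gen_ideal S : is_ideal (ideal_gen S).
Proof.
split.
- by move=> J [[J0 _ _] _].
- by move=> f g Sf Sg J hJ; case: (hJ) => -[_ JD _] _; apply: JD; [exact: Sf|exact: Sg].
- by move=> a f Sf J hJ; case: (hJ) => -[_ _ JM] _; apply: JM; exact: Sf.
Qed.

Lemma sub_ideal_gen S : S `<=` ideal_gen S.
Proof. exact: sub_gen_smallest. Qed.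

Lemma ideal_gen_sub {S I} : is_ideal I -> S `<=` I -> ideal_gen S `<=` I.
Proof. by move=> hI hS; apply: smallest_sub. Qed.

Lemma ideal_sum {I} (T : Type) (r : seq T) (Q : pred T) (F : T -> A) :
  is_ideal I -> (forall i, Q i -> I (F i)) -> I (\sum_(i <- r | Q i) F i).
Proof. by move=> [I0 ID _] h; elim/big_ind: _. Qed.

Lemma ideal_opp {I} f : is_ideal I -> I f -> I (- f).
Proof. by move=> [_ _ IM] If; rewrite -mulN1r; exact: IM. Qed.

Lemma ideal_genP m (f : 'I_m -> A) h :
  ideal_gen (range f) h -> exists c : 'I_m -> A, h = \sum_i c i * f i.
Proof.
move: h; apply: ideal_gen_sub; first split.
- by exists (fun=> 0); rewrite big1// => i _; rewrite mul0r.
- move=> _ _ [c ->] [d ->]; exists (fun i => c i + d i).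
  by rewrite -big_split; apply: eq_bigr => i _; rewrite mulrDl.
- move=> a _ [c ->]; exists (fun i => a * c i).
  by rewrite mulr_sumr; apply: eq_bigr => i _; rewrite mulrA.
- move=> _ [i _ <-]; exists (fun j => (j == i)%:R).
  rewrite (bigD1 i)//= eqxx mul1r big1 ?addr0// => j /negPf ->.
  by rewrite mul0r.
Qed.

Lemma ideal_mulP {I J f g} : I f -> J g -> ideal_mul I J (f * g).
Proof. by move=> If Jg; apply: sub_ideal_gen; exists f, g. Qed.

(** One finite generating family makes the set defining [mu] nonempty, so [xget] returns a true
    minimum and not its default. *)
Lemma gen_by_mu {I m} : gen_by I m -> gen_by I (mu I) /\ (mu I <= m)%N.
Proof.
move=> Im.
have [] : [set p | gen_by I p /\ forall q, gen_by I q -> (p <= q)%N] (mu I).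
  apply: (@xgetPex _ 0%N).
  have ex : exists p, `[< gen_by I p >] by exists m; apply/asboolP.
  case: (ex_minnP ex) => p /asboolP Ip hp; exists p; split=> // q Iq.
  by apply: hp; apply/asboolP.
by move=> ? h; split=> //; exact: h.
Qed.

Lemma gen_by_finType {I} (T : finType) (f : T -> A) :
  I = ideal_gen (range f) -> gen_by I #|T|.
Proof.
move=> ->; exists (fun i => f (enum_val i)); congr ideal_gen.
apply/seteqP; split=> [_ [t _ <-]|_ [i _ <-]]; last by exists (enum_val i).
by exists (enum_rank t) => //; rewrite enum_rankK.
Qed.

Lemma mu_gt0 {I m} : gen_by I m -> (exists2 f, I f & f != 0) -> (0 < mu I)%N.
Proof.
move=> /gen_by_mu[+ _] [f If f0]; case: (mu I) => // -[g eI].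
have [c] : exists c : 'I_0 -> A, f = \sum_i c i * g i.
  by apply: ideal_genP; rewrite -eI.
by rewrite big_ord0 => fE; rewrite fE eqxx in f0.
Qed.

End IdealGeneralities.

Lemma row_kernel (F : fieldType) p q (M : 'M[F]_(p, q)) :
  (q < p)%N -> exists2 c : 'rV[F]_p, c != 0 & c *m M = 0.
Proof.
move=> qp; have : kermx M != 0.
  rewrite kermx_eq0 /row_free neq_ltn; apply/orP; left.
  exact: leq_ltn_trans (rank_leq_col _) qp.
move=> /rowV0Pn[c /sub_kermxP cM c0]; by exists c.
Qed.

(** * Monomials with all exponents below a bound *)

Section MonomialBoxes.
Context {k : fieldType} {n : nat}.
Local Notation A := {mpoly k[n]}.
Implicit Types (I : set A) (m : 'X_{1..n}).

(** The exponents range over a finite function type, so that the box has [N ^ n] elements by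
    [card_ffun] and can index sums and matrices. *)
Definition box_mon N (a : {ffun 'I_n -> 'I_N}) : 'X_{1..n} := [multinom (a i : nat) | i < n].
Arguments box_mon : clear implicits.

Lemma box_mon_inj N : injective (box_mon N).
Proof.
by move=> a b /mnmP ab; apply/ffunP => i; apply/val_inj; have := ab i; rewrite !mnmE.
Qed.

Lemma box_monP N m : (forall i, (m i < N)%N) -> exists a, m = box_mon N a.
Proof.
move=> h; exists [ffun i => Ordinal (h i)]; apply/mnmP => i.
by rewrite !mnmE ffunE.
Qed.

Lemma ideal_mpoly_supp I (f : A) : is_ideal I ->
  (forall m, m \in msupp f -> I 'X_[m]) -> I f.
Proof.
move=> hI hf; rewrite (mpolyE f) big_seq_cond; apply: ideal_sum => // m.
rewrite andbT => /hf; rewrite -mul_mpolyC.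
by have [_ _ IM] := hI; exact: IM.
Qed.

Lemma ideal_monomial_ge {I N m} (i : 'I_n) : is_ideal I -> I ('X_i ^+ N) ->
  (N <= m i)%N -> I 'X_[m].
Proof.
move=> [_ _ IM] IX Nm.
have -> : m = ((m - U_(i) *+ N) + U_(i) *+ N)%MM.
  apply/mnmP => j; rewrite mnmDE mnmBE mulmnE mnm1E.
  by case: eqVneq => [<-|_]; rewrite ?mul1n ?subnK// mul0n subn0 addn0.
by rewrite mpolyXD -mpolyXn; exact: IM.
Qed.

(** A monomial outside the box is divisible by some ['X_i ^+ N], so truncating [f] to the box
    changes it by an element of [I]. *)
Lemma span_mod_ideal {I} N : is_ideal I -> (forall i : 'I_n, I ('X_i ^+ N)) ->
  forall f : A, exists c : {ffun 'I_n -> 'I_N} -> k,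
    I (f - \sum_a c a *: 'X_[box_mon N a]).
Proof.
move=> hI IX f; exists (fun a => f@_(box_mon N a)).
apply: ideal_mpoly_supp => // m; rewrite mcoeff_msupp linearB linear_sum /=.
have [h|] := boolP [forall i, (m i < N)%N]; last first.
  by rewrite negb_forall => /existsP[i]; rewrite -leqNgt => /(ideal_monomial_ge _ hI (IX i)).
have [a ->] := box_monP _ _ (forallP h).
rewrite (bigD1 a)//= linearZ /= mcoeffX eqxx mulr1 big1 ?addr0 ?subrr ?eqxx// => b ba.
by rewrite linearZ /= mcoeffX (inj_eq (@box_mon_inj N)) (negPf ba) mulr0.
Qed.

End MonomialBoxes.
Arguments box_mon {n} N a.

(** * Upper bound for the number of generators by leading monomials *)

Section GeneratorBound.
Context {k : fieldType} {n : nat}.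
Local Notation A := {mpoly k[n.+1]}.
Implicit Types (I : set A) (m : 'X_{1..n.+1}).

Lemma mlead_cancel (f h : A) : mlead h = mlead f -> mleadc h = mleadc f ->
  f - h != 0 -> (mlead (f - h) < mlead f)%O.
Proof.
move=> hf hc fh0; rewrite Order.POrderTheory.lt_neqAle; apply/andP; split; last first.
  by have := mleadB_le f h; rewrite hf joinxx.
apply: contra fh0 => /eqP E.
by rewrite -mleadc_eq0 E mcoeffB -{2}hf hc subrr.
Qed.

(** A line of exponents parallel to the last axis: [a] fixes the other exponents and [j] is the last
    one. *)
Definition line_mon N (a : {ffun 'I_n -> 'I_N}) (j : nat) : 'X_{1..n.+1} :=
  [multinom (if unlift ord_max i is Some i' then a i' : nat else j) | i < n.+1].

(** Along a line only the last exponent varies, so the lowest leading monomial of [I] on it divides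
    all the others there. Hence one generator per line in the box, together with the powers of the
    variables, suffices for division. *)
Lemma gen_by_box {I} N : is_ideal I -> (forall i : 'I_n.+1, I ('X_i ^+ N)) ->
  gen_by I (n.+1 + N ^ n).
Proof.
move=> hI IX; have [I0 ID IM] := hI.
(* [g a] realises the lowest leading monomial of [I] on the line of [a]; the witness is 0 if there
   is none. *)
have /boolp.choice[g hg] : forall a : {ffun 'I_n -> 'I_N}, exists g : A, I g /\
    forall h j, I h -> h != 0 -> mlead h = line_mon N a j ->
    g != 0 /\ exists2 j0, (j0 <= j)%N & mlead g = line_mon N a j0.
  move=> a.
  pose Q j := `[< exists h, [/\ I h, h != 0 & mlead h = line_mon N a j] >].
  have [ex|nex] := pselect (exists j, Q j); last first.
    exists 0; split=> // h j Ih h0 hj; case: nex; exists j.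
    by apply/asboolP; exists h.
  case: (ex_minnP ex) => j0 /asboolP[g [Ig g0 gj]] hmin.
  exists g; split=> // h j Ih h0 hj; split=> //; exists j0 => //.
  by apply: hmin; apply/asboolP; exists h.
pose F (t : 'I_n.+1 + {ffun 'I_n -> 'I_N}) : A :=
  match t with inl i => 'X_i ^+ N | inr a => g a end.
have -> : (n.+1 + N ^ n)%N = #|{: 'I_n.+1 + {ffun 'I_n -> 'I_N}}|.
  by rewrite card_sum card_ffun !card_ord.
apply: (@gen_by_finType _ _ _ F).
pose J := ideal_gen (range F).
have hJ : is_ideal J := ideal_gen_ideal _.
have [J0 JD JM] := hJ.
have JF t : J (F t) by apply: sub_ideal_gen; exists t.
apply/seteqP; split; last first.
  apply: ideal_gen_sub => // _ [[i|a] _ <-] /=; first exact: IX.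
  by have [] := hg a.
suff H : forall m f, mlead f = m -> I f -> J f by move=> f; exact: H.
apply: (well_founded_ind (@ltom_wf n.+1)) => m IH f fm If.
have [->//|f0] := eqVneq f 0.
(* Division step: subtracting an [h] with the same leading term leaves an element of [I] that is 0
   or has a smaller leading monomial. *)
suff [h [Jh Ih hm hc]] : exists h, [/\ J h, I h, mlead h = mlead f & mleadc h = mleadc f].
  rewrite -(subrK h f); apply: (JD) => //.
  have [->//|fh0] := eqVneq (f - h) 0.
  apply: (IH (mlead (f - h))) => //; first by rewrite -fm; exact: mlead_cancel.
  by apply: (ID) => //; exact: ideal_opp.
have fc0 : mleadc f != 0 by rewrite mleadc_eq0.
have [small|] := boolP [forall i, (m i < N)%N]; last first.
  rewrite negb_forall => /existsP[i]; rewrite -leqNgt => Nm.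
  exists (mleadc f *: 'X_[m]); rewrite mleadZ// mleadXm fm mcoeffZ mcoeffX eqxx mulr1.
  split=> //; rewrite -mul_mpolyC.
    by apply: (JM); apply: (ideal_monomial_ge i hJ _ Nm); exact: (JF (inl i)).
  by apply: (IM); exact: (ideal_monomial_ge i hI _ Nm).
pose a : {ffun 'I_n -> 'I_N} := [ffun i => Ordinal (forallP small (lift ord_max i))].
have mE : m = line_mon N a (m ord_max).
  apply/mnmP => i; rewrite mnmE; case: unliftP => [i' ->|->//].
  by rewrite ffunE.
have [Iga /(_ f (m ord_max) If f0)] := hg a.
rewrite fm => /(_ mE)[ga0 [j0 j0m gj]].
(* The truncated subtraction is exact, because the two exponents differ only in the last entry and
   [j0] is at most that of [m]. *)
pose u := (m - mlead (g a))%MM.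
have mu : (u + mlead (g a))%MM = m.
  apply/mnmP => i; rewrite mnmDE mnmBE subnK// gj mE !mnmE.
  by case: unliftP.
have gc0 : mleadc (g a) != 0 by rewrite mleadc_eq0.
exists ((mleadc f / mleadc (g a)) *: ('X_[u] * g a)).
have X0 : ('X_[u] : A) != 0 by rewrite -mleadc_eq0 mleadXm mcoeffX eqxx oner_eq0.
have lE : mlead ('X_[u] * g a) = m by rewrite mleadM// mleadXm.
split.
- by rewrite -mul_mpolyC; apply: (JM); apply: (JM); exact: (JF (inr a)).
- by rewrite -mul_mpolyC; apply: (IM); apply: (IM).
- by rewrite mleadZ ?mulf_neq0 ?invr_eq0// lE.
rewrite mleadZ ?mulf_neq0 ?invr_eq0// mcoeffZ lE.
have -> : ('X_[u] * g a)@_m = mleadc (g a).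
  by rewrite -lE mleadM// mleadcM mleadXm mcoeffX eqxx mul1r.
rewrite divfK; [by rewrite fm|exact: gc0].
Qed.

End GeneratorBound.

(** * Dimension of quotients by ideals, and elements supported in a box *)

Section QuotientDimension.
Context {k : fieldType} {n : nat}.
Local Notation A := {mpoly k[n]}.
Implicit Types (I : set A).

(** Expresses that the quotient by [I] has dimension at most [D], without forming the quotient
    space. *)
Definition spanned_mod I D := exists h : 'I_D -> A,
  forall f, exists c : 'I_D -> k, I (f - \sum_i c i *: h i).

Lemma spanned_mod_finType {I} (T : finType) (h : T -> A) :
  (forall f, exists c : T -> k, I (f - \sum_i c i *: h i)) -> spanned_mod I #|T|.
Proof.
move=> hI; exists (fun i => h (enum_val i)) => f.
have [c hc] := hI f; exists (fun i => c (enum_val i)).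
congr I: hc; congr (_ - _).
by rewrite -(big_enum_val (fun t => c t *: h t)).
Qed.

(** A spanning family modulo [I] is completed by one for [I] modulo [J I]: the products of [mu I]
    generators of [I] with the [N ^ n] box monomials, which span modulo [J]. *)
Lemma spanned_mod_mul {I J Q : set A} N D : is_ideal I -> is_ideal Q -> ideal_mul J I `<=` Q ->
  is_ideal J -> (forall i : 'I_n, J ('X_i ^+ N)) ->
  gen_by I (mu I) -> spanned_mod I D -> spanned_mod Q (D + mu I * N ^ n).
Proof.
move=> hI hQ JIQ hJ JX [g gE] [h hD].
pose H (t : 'I_D + 'I_(mu I) * {ffun 'I_n -> 'I_N}) : A :=
  match t with inl i => h i | inr p => 'X_[box_mon N p.2] * g p.1 end.
have -> : (D + mu I * N ^ n)%N = #|{: 'I_D + 'I_(mu I) * {ffun 'I_n -> 'I_N}}|.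
  by rewrite card_sum card_prod card_ffun !card_ord.
apply: (@spanned_mod_finType _ _ H) => f.
have [c hc] := hD f.
have [a fE] : exists a, f - \sum_i c i *: h i = \sum_i a i * g i.
  by apply: ideal_genP; rewrite -gE.
have /boolp.choice[d hd] := fun i => span_mod_ideal N hJ JX (a i).
exists (fun t => match t with inl i => c i | inr p => d p.1 p.2 end).
rewrite big_sumType /= opprD addrA fE.
rewrite -(pair_bigA _ (fun i b => d i b *: ('X_[box_mon N b] * g i))) /= -sumrB.
apply: ideal_sum => // i _; apply: JIQ.
have -> : a i * g i - \sum_b d i b *: ('X_[box_mon N b] * g i) =
    (a i - \sum_b d i b *: 'X_[box_mon N b]) * g i.
  rewrite mulrBl mulr_suml; congr (_ - _); apply: eq_bigr => b _.
  by rewrite scalerAl.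
by apply: ideal_mulP; [exact: hd|rewrite gE; apply: sub_ideal_gen; exists i].
Qed.

Lemma spanned_mod_graded {I : nat -> set A} N M : graded_family I ->
  (forall i : 'I_n, I 1%N ('X_i ^+ N)) ->
  (forall j, (0 < j)%N -> gen_by (I j) (mu (I j))) ->
  spanned_mod (I M.+1) (N ^ n * (1 + \sum_(1 <= j < M.+1) mu (I j))).
Proof.
move=> [hI hII] IX Ig; elim: M => [|M IH].
  have -> : (N ^ n * (1 + \sum_(1 <= j < 1) mu (I j)))%N = #|{: {ffun 'I_n -> 'I_N}}|.
    by rewrite big_nil muln1 card_ffun !card_ord.
  apply: (@spanned_mod_finType _ _ (fun b => 'X_[box_mon N b])) => f.
  by apply: span_mod_ideal => //; exact: hI.
rewrite big_nat_recr//= addnA mulnDr [X in (_ + X)%N]mulnC.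
apply: (@spanned_mod_mul _ (I 1%N) _ _ _ (hI _ _) (hI _ _)) => //.
- exact: (hII 1%N M.+1).
- exact: hI.
- exact: Ig.
Qed.

(** The box has more monomials than [D], so some nontrivial combination of them vanishes modulo
    [I]. *)
Lemma spanned_mod_box {I} D N : spanned_mod I D -> is_ideal I -> (D < N ^ n)%N ->
  exists f, [/\ I f, f != 0 & forall m, m \in msupp f -> forall i, (m i < N)%N].
Proof.
move=> [h hI] II DN; pose T := {ffun 'I_n -> 'I_N}.
have {DN} DT : (D < #|{: T}|)%N by rewrite card_ffun !card_ord.
have /boolp.choice[d hd] := fun b : T => hI 'X_[box_mon N b].
(* Row [b] holds the coordinates of the box monomial [b] modulo [I]; a left kernel vector gives the
   combination. *)
have [c c0 cM] := @row_kernel k _ _ (\matrix_(b, j) d (enum_val b) j : 'M_(#|T|, D)) DT.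
pose f : A := \sum_b c 0 b *: 'X_[box_mon N (enum_val b)].
have fE b : f@_(box_mon N (enum_val b)) = c 0 b.
  rewrite /f linear_sum (bigD1 b)//= linearZ /= mcoeffX eqxx mulr1 big1 ?addr0// => j jb.
  by rewrite linearZ /= mcoeffX (inj_eq (@box_mon_inj _ _)) (inj_eq enum_val_inj) (negPf jb) mulr0.
exists f; split.
- have -> : f = \sum_b c 0 b *: ('X_[box_mon N (enum_val b)] - \sum_j d (enum_val b) j *: h j).
    rewrite -[LHS]subr0; under [RHS]eq_bigr do rewrite scalerBr.
    rewrite sumrB; congr (_ - _); under eq_bigr do rewrite scaler_sumr.
    rewrite exchange_big /= big1// => j _.
    under eq_bigr do rewrite scalerA.
    rewrite -scaler_suml; move/rowP/(_ j): cM; rewrite !mxE => cj.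
    rewrite [X in X *: _](_ : _ = 0) ?scale0r// -[RHS]cj.
    by apply: eq_bigr => b _; rewrite mxE.
  by apply: ideal_sum => // b _; rewrite -mul_mpolyC; have [_ _ IM] := II; exact: IM.
- apply: contra c0 => /eqP f0; apply/eqP/rowP => b.
  by rewrite -fE f0 mcoeff0 mxE.
move=> m; rewrite mcoeff_msupp => fm i; rewrite ltnNge; apply: contra fm => Nm.
rewrite linear_sum big1// => b _; rewrite linearZ /= mcoeffX.
case: eqVneq => [bm|_]; last by rewrite mulr0.
by move: Nm; rewrite -bm mnmE leqNgt ltn_ord.
Qed.

End QuotientDimension.

(** * Krull dimension of the polynomial ring *)

Section PrimeChains.
Context {k : fieldType} {n : nat}.
Local Notation A := {mpoly k[n]}.
Implicit Types (P : set A).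

(** Setting the first [i] variables to 0; the kernel of this substitution is the prime ideal that
    they generate. *)
Definition kill_vars (i : nat) : n.-tuple A :=
  [tuple if (j < i)%N then 0 else 'X_j | j < n].

Lemma kill_vars_prime i : is_prime [set f : A | f \mPo kill_vars i = 0].
Proof.
split; first split=> /=.
- exact: comp_mpoly0.
- by move=> f g /= f0 g0; rewrite comp_mpolyD f0 g0 addr0.
- by move=> a f /= f0; rewrite rmorphM /= f0 mulr0.
- by rewrite /= comp_mpoly1; apply/eqP; exact: oner_neq0.
move=> f g /=; rewrite rmorphM => /eqP; rewrite mulf_eq0.
by move=> /orP[] /eqP; [left|right].
Qed.

(** This makes the kernels increase with [i]. *)
Lemma kill_vars_comp i j f : (i <= j)%N ->
  (f \mPo kill_vars i) \mPo kill_vars j = f \mPo kill_vars j.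
Proof.
move=> ij; rewrite [f \mPo kill_vars i]comp_mpolyEX [RHS]comp_mpolyEX raddf_sum /=.
apply: eq_bigr => m _; rewrite comp_mpolyZ !comp_mpolyX rmorph_prod /=.
congr (_ *: _); apply: eq_bigr => l _; rewrite rmorphXn /= !tnth_mktuple.
case: ifPn => li; first by rewrite comp_mpoly0 (leq_trans li ij).
by rewrite comp_mpolyXU -tnth_nth tnth_mktuple.
Qed.

Lemma prime_chain_vars : @prime_chain A n.
Proof.
exists (fun i => [set f : A | f \mPo kill_vars i = 0]); split=> [i|i j ij].
  exact: kill_vars_prime.
split=> [f /= f0|]; first by rewrite -(@kill_vars_comp i)// ?(ltnW ij)// f0 comp_mpoly0.
have iN : (i < n)%N by apply: leq_trans ij _; rewrite -ltnS.
move=> /(_ 'X_(Ordinal iN)) /=.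
rewrite !comp_mpolyXU -!tnth_nth !tnth_mktuple /= ltnn ij => /(_ erefl) /eqP.
by rewrite -mleadc_eq0 mleadXm mcoeffX eqxx oner_eq0.
Qed.

(** Exponents are lists, so that induction along a chain can split off the first element [f 0] and
    shift the rest. *)
Fixpoint expo_seqs (D e : nat) : seq (seq nat) :=
  if e is e'.+1 then [seq j :: s | j <- iota 0 D, s <- expo_seqs D e'] else [:: [::]].

Fixpoint power_prod (f : nat -> A) (s : seq nat) : A :=
  if s is j :: s' then f 0%N ^+ j * power_prod (fun i => f i.+1) s' else 1.

Lemma size_expo_seqs D e : size (expo_seqs D e) = (D ^ e)%N.
Proof. by elim: e => //= e IH; rewrite size_allpairs size_iota IH expnS. Qed.

Lemma uniq_expo_seqs D e : uniq (expo_seqs D e).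
Proof.
elim: e => //= e IH; apply: allpairs_uniq => //; first exact: iota_uniq.
by move=> [j s] [j' s'] _ _ /= [-> ->].
Qed.

Lemma prime_cancel {P f j g} : is_prime P -> ~ P f -> P (f ^+ j * g) -> P g.
Proof.
move=> [_ _ PP] Pf; elim: j => [|j IH]; first by rewrite mul1r.
by rewrite exprS -mulrA => /PP[].
Qed.

(* Factor out the least power of [f 0] that occurs in the relation: its
   cofactor lies in [P 0], and modulo [f 0], hence in [P 1], it is a shorter
   relation. *)
Lemma prime_chain_independent {D e} {P : nat -> set A} {f : nat -> A} {c : seq nat -> k} :
  (forall i, (i <= e)%N -> is_prime (P i)) ->
  (forall i, (i < e)%N -> [/\ P i `<=` P i.+1, P i.+1 (f i) & ~ P i (f i)]) ->
  P 0%N (\sum_(s <- expo_seqs D e) c s *: power_prod f s) ->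
  forall s, s \in expo_seqs D e -> c s = 0.
Proof.
elim: e P f c => [|e IH] P f c hP hf.
  rewrite big_seq1 /= => Pc s; rewrite inE => /eqP ->.
  have [->//|c0] := eqVneq (c [::]) 0.
  have [[_ _ PM] P1 _] := hP 0%N isT; case: P1.
  rewrite -[1](scale1r) -(mulVf c0) -scalerA -mul_mpolyC.
  exact: PM.
pose Q j := \sum_(s <- expo_seqs D e) c (j :: s) *: power_prod (fun i => f i.+1) s.
have hQ j : P 1%N (Q j) -> forall s, s \in expo_seqs D e -> c (j :: s) = 0.
  apply: (IH (fun i => P i.+1) (fun i => f i.+1) (fun s => c (j :: s))) => i ie.
    exact: hP.
  exact: hf.
have -> : \sum_(s <- expo_seqs D e.+1) c s *: power_prod f s =
    \sum_(0 <= j < D) f 0%N ^+ j * Q j.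
  rewrite big_allpairs_dep /= /index_iota subn0; apply: eq_bigr => j _.
  by rewrite mulr_sumr; apply: eq_bigr => s _; rewrite scalerAr.
move=> PQ; have [P01 P1f P0f] := hf 0%N isT.
suff H j : (j <= D)%N -> forall i s, (i < j)%N -> s \in expo_seqs D e -> c (i :: s) = 0.
  move=> s /allpairsP[[j s'] /= [jD s'D ->]].
  by apply: (H D) => //; rewrite mem_iota in jD.
elim: j => [//|j IHj] jD i s; rewrite ltnS leq_eqVlt => /orP[/eqP ->{i}|ij]; last first.
  by apply: IHj => //; exact: ltnW.
apply: hQ.
have [hP0 _ _] := hP 0%N isT; have [[_ P1D P1M] _ _] := hP 1%N isT.
move: PQ; rewrite (big_cat_nat (n:=j))//=; last exact: ltnW.
rewrite big_nat big1 ?add0r => [|i /= ij]; last first.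
  rewrite /Q big_seq big1 ?mulr0// => t tD.
  by rewrite (IHj (ltnW jD))// scale0r.
rewrite big_ltn//.
have -> : \sum_(j.+1 <= i < D) f 0%N ^+ i * Q i =
    f 0%N ^+ j * (f 0%N * \sum_(j.+1 <= i < D) f 0%N ^+ (i - j.+1) * Q i).
  rewrite mulrA -exprSr mulr_sumr big_nat [RHS]big_nat; apply: eq_bigr => i /andP[ji _].
  by rewrite mulrA -exprD subnKC.
rewrite -mulrDr => /(prime_cancel (hP 0%N isT) P0f)/P01 PQf.
rewrite -[Q j](addrK (f 0%N * \sum_(j.+1 <= i < D) f 0%N ^+ (i - j.+1) * Q i)).
apply: (P1D) => //; apply: ideal_opp; first by have [] := hP 1%N isT.
by rewrite mulrC; exact: P1M.
Qed.

Definition deg_le (d : nat) (f : A) := forall m, m \in msupp f -> (mdeg m <= d)%N.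

Lemma deg_leM {d e f g} : deg_le d f -> deg_le e g -> deg_le (d + e) (f * g).
Proof.
move=> fd ge m /msuppM_le/allpairsP[[m1 m2] /= [h1 h2 ->]].
by rewrite mdegD leq_add ?fd ?ge.
Qed.

Lemma deg_leX {d} j {f} : deg_le d f -> deg_le (j * d) (f ^+ j).
Proof.
move=> fd; elim: j => [|j IH]; last by rewrite exprS mulSn; exact: deg_leM.
by move=> m; rewrite expr0 msupp1 inE => /eqP ->; rewrite mdeg0.
Qed.

Lemma deg_le_power_prod {D e d} {f : nat -> A} {s} : (forall i, (i < e)%N -> deg_le d (f i)) ->
  s \in expo_seqs D e -> deg_le (e * (D * d)) (power_prod f s).
Proof.
elim: e f s => [|e IH] f s fd.
  by rewrite inE => /eqP -> m; rewrite /= msupp1 inE => /eqP ->; rewrite mdeg0.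
move=> /allpairsP[[j s'] /= [jD s'D ->]] /=.
rewrite mulSn => m /deg_leM h.
have jd : (j * d + e * (D * d) <= D * d + e * (D * d))%N.
  by rewrite leq_add2r leq_mul2r; move: jD; rewrite mem_iota => /andP[_ /ltnW ->]; rewrite orbT.
apply: leq_trans jd; apply: h; first by apply: deg_leX; exact: fd.
by apply: IH => // i ie; exact: fd.
Qed.

Lemma algebraic_dependence (f : nat -> A) : exists D (c : seq nat -> k),
  (exists2 s, s \in expo_seqs D n.+1 & c s != 0) /\
  \sum_(s <- expo_seqs D n.+1) c s *: power_prod f s = 0.
Proof.
pose d := (\max_(i < n.+1) msize (f i))%N.
have fd i : (i < n.+1)%N -> deg_le d (f i).
  move=> ie m /msize_mdeg_lt/ltnW/leq_trans; apply.
  exact: (@leq_bigmax _ (fun i : 'I_n.+1 => msize (f i)) (Ordinal ie)).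
(* The [D ^ n.+1] products have degree below [N], and [N <= C * D]. As [D > C ^ n], there are at
   most [(C * D) ^ n < D ^ n.+1] monomials to express them. *)
pose C := (n.+1 * d).+1; pose D := (C ^ n).+1; pose N := (n.+1 * (D * d)).+1.
exists D; pose E := expo_seqs D n.+1.
have EN : (#|{: {ffun 'I_n -> 'I_N}}| < size E)%N.
  rewrite card_ffun !card_ord size_expo_seqs.
  apply: (@leq_ltn_trans ((C * D) ^ n)); last first.
    by rewrite expnMn expnS ltn_pmul2r// expn_gt0.
  have mono a b j : (a <= b -> a ^ j <= b ^ j)%N by case: j => // j; rewrite leq_exp2r.
  by apply: mono; rewrite [leqRHS]mulSn -mulnA [(d * D)%N]mulnC -[leqLHS]add1n leq_add.
have Ed (i : 'I_(size E)) : deg_le (n.+1 * (D * d)) (power_prod f (nth [::] E i)).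
  by apply: (deg_le_power_prod fd); exact: mem_nth.
have [c c0 cM] := @row_kernel k _ _ (\matrix_(i, b)
  (power_prod f (nth [::] E i))@_(box_mon N (enum_val b)) :
    'M_(size E, #|{: {ffun 'I_n -> 'I_N}}|)) EN.
(* The kernel vector is indexed by positions in [E]; [c'] reads it as a function of the exponent
   list, with value 0 off [E]. *)
pose c' s := oapp (c 0) 0 (insub (index s E)).
have c'E (i : 'I_(size E)) : c' (nth [::] E i) = c 0 i.
  by rewrite /c' index_uniq ?uniq_expo_seqs// valK.
exists c'; split.
  have [i ci] : exists i, c 0 i != 0 by apply/rV0Pn.
  by exists (nth [::] E i); rewrite ?mem_nth// c'E.
rewrite (big_nth [::]) big_mkord.
under eq_bigr do rewrite c'E.
apply/mpolyP => m; rewrite mcoeff0 linear_sum /=.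
under eq_bigr do rewrite linearZ /=.
have [mN|] := boolP [forall i, (m i < N)%N].
  have [b ->] := box_monP _ _ (forallP mN).
  move/rowP/(_ (enum_rank b)): cM; rewrite !mxE => cb.
  by rewrite -[RHS]cb; apply: eq_bigr => i _; rewrite mxE enum_rankK.
rewrite negb_forall => /existsP[j]; rewrite -leqNgt => Nm.
rewrite big1// => i _; rewrite memN_msupp_eq0 ?mulr0//.
apply/negP => /(Ed i).
rewrite leqNgt => /negP; apply; apply: leq_trans Nm _.
by rewrite mdegE (bigD1 j)//= leq_addr.
Qed.

Lemma krull_dim_mpoly : krull_dim A n.
Proof.
split=> [|e [P [Pp PS]]]; first exact: prime_chain_vars.
rewrite leqNgt; apply/negP => ne.
(* The chain is reindexed by natural numbers; only its first [n.+1] strict inclusions enter the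
   argument. *)
pose P' i := P (inord i).
have /boolp.choice[f hf] i : exists f, (i < e)%N -> P' i.+1 f /\ ~ P' i f.
  have [ie|] := boolP (i < e)%N; last by exists 0.
  have [_ /existsNP[f /not_implyP[Pf nPf]]] : P' i `<` P' i.+1.
    by apply: PS; rewrite !inordK ?ltnS// ltnW.
  by exists f.
have [D [c [[s sE cs] c0]]] := algebraic_dependence f.
move/eqP: cs; apply; apply: (@prime_chain_independent D n.+1 P' f) sE.
- by move=> i _; exact: Pp.
- move=> i ie; have ie' : (i < e)%N by apply: leq_trans ie _.
  have [? ?] := hf _ ie'; split=> //.
  by have [] : P' i `<` P' i.+1 by apply: PS; rewrite !inordK ?ltnS// ltnW.
by rewrite c0; have [[]] := Pp (inord 0).
Qed.

End PrimeChains.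

(** * Valuations and supports of polynomials *)

Lemma ultrametric_add (K G : zmodType) (le : rel G) (v : K -> G) (f g : K) :
  group_total_order le -> (forall x, x != 0 -> v (- x) = v x) ->
  (forall x y, x != 0 -> y != 0 -> x + y != 0 ->
    le (if le (v x) (v y) then v x else v y) (v (x + y))) ->
  f != 0 -> g != 0 -> f + g != 0 -> v f != v g ->
  v (f + g) = v f \/ v (f + g) = v g.
Proof.
move=> [lexx lea let_ letot _] vN vD.
wlog fg : f g / le (v f) (v g) => [H f0 g0 fg0 vfg|f0 g0 fg0 vfg].
  have [fg|gf] := orP (letot (v f) (v g)); first exact: H.
  rewrite addrC or_comm; apply: H => //; first by rewrite addrC.
  by rewrite eq_sym.
(* The ultrametric inequality for [f + g] bounds its value from below by [v f]; the one for
   [f = (f + g) - g] bounds it from above. *)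
left; have := vD f g f0 g0 fg0; rewrite fg => h1.
have gN0 : - g != 0 by rewrite oppr_eq0.
have := vD (f + g) (- g) fg0 gN0; rewrite addrK => /(_ f0).
rewrite vN//; case: ifP => _ h2; first by apply: (lea); rewrite h2 h1.
by move/eqP: vfg; case; apply: (lea); rewrite fg h2.
Qed.

Section ValuationSupport.
Context {k : fieldType} {n : nat}.
Local Notation A := {mpoly k[n]}.
Local Notation "x %:F" := (tofrac x).
Context {le : rel 'rV[int]_n} {v : {fraction A} -> 'rV[int]_n}.
Context (le_order : group_total_order le) (v_val : is_valuation le v).
Context (v_mon : respects_monomials v).

Lemma valuation_opp f : f != 0 -> v (- f) = v f.
Proof.
have [_ _ vc] := v_val; move=> f0.
rewrite -mulN1r -(vc (-1) f)// ?oppr_eq0 ?oner_eq0//.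
by rewrite mpolyCN rmorphN rmorph1.
Qed.

(** Induction on the terms: the new monomial is not in the support of [g], so the two values differ
    and the value of the sum is one of them. *)
Lemma valuation_mem_msupp (f : A) : f != 0 ->
  exists2 m, m \in msupp f & v f%:F = \row_i (m i)%:Z.
Proof.
have [_ _ vc] := v_val.
elim/mpolyind: f => [|c m g mg c0 IH]; first by rewrite eqxx.
have cX : v (c *: 'X_[m])%:F = \row_i (m i)%:Z.
  rewrite -mul_mpolyC rmorphM vc ?v_mon// tofrac_eq0 -mleadc_eq0 mleadXm mcoeffX eqxx.
  exact: oner_neq0.
have mf : m \in msupp (c *: 'X_[m] + g).
  by rewrite mcoeff_msupp mcoeffD mcoeffZ mcoeffX eqxx mulr1 (memN_msupp_eq0 mg) addr0.
have [->|g0] := eqVneq g 0.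
  by move=> _; exists m; rewrite addr0// mcoeff_msupp mcoeffZ mcoeffX eqxx mulr1.
move=> f0; have [m' m'g vg] := IH g0.
have mm' : m != m' by apply: contraNneq mg => ->.
have cX0 : c *: 'X_[m] != 0 :> A.
  by rewrite -mleadc_eq0 mleadZ// mleadXm mcoeffZ mcoeffX eqxx mulr1.
have [_ vD _] := v_val.
have [] := @ultrametric_add _ _ le v (c *: 'X_[m])%:F g%:F le_order valuation_opp vD;
  rewrite -?rmorphD ?tofrac_eq0 //= ?cX ?vg.
- apply: contra mm' => /eqP/rowP e; apply/eqP/mnmP => i.
  by have := e i; rewrite !mxE => -[].
- by move=> ->; exists m.
move=> ->; exists m' => //; rewrite mcoeff_msupp mcoeffD mcoeffZ mcoeffX (negPf mm').
by rewrite mulr0 add0r -mcoeff_msupp.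
Qed.

End ValuationSupport.

(** * Linear forms, half-spaces and generic directions *)

Section Geometry.
Context {R : realType}.

(** With [p] the slacks of the constraints at a point and [q] their change along a direction, a
    short step that keeps the tight constraints tight stays feasible. *)
Lemma small_step (T : finType) (p q : T -> R) :
  (forall t, 0 <= p t) -> (forall t, p t = 0 -> q t = 0) ->
  exists2 e, 0 < e & forall t, 0 <= p t + e * q t.
Proof.
move=> p0 pq; pose S := 1 + \sum_t `|q t| / p t.
have S0 : 0 < S.
  by rewrite ltr_pwDl// sumr_ge0// => t _; rewrite divr_ge0.
exists S^-1; first by rewrite invr_gt0.
move=> t; have [/pq ->|pt0] := eqVneq (p t) 0; first by rewrite mulr0 addr0.
have {}pt0 : 0 < p t by rewrite lt_neqAle eq_sym pt0 p0.
have : `|q t| <= S * p t.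
  rewrite -ler_pdivrMr// /S (bigD1 t)//= addrCA lerDl addr_ge0// sumr_ge0// => i _.
  by rewrite divr_ge0.
rewrite ler_norml => /andP[+ _]; rewrite -subr_ge0 opprK => h.
have -> : p t + S^-1 * q t = S^-1 * (q t + S * p t).
  by rewrite mulrDr mulKf ?lt0r_neq0// addrC.
by rewrite mulr_ge0// invr_ge0 ltW.
Qed.

Context {n : nat}.
Implicit Types (a x y u : 'rV[R]_n.+1) (C F : set 'rV[R]_n.+1).

Lemma dotD a x y : dot a (x + y) = dot a x + dot a y.
Proof. by rewrite /dot -big_split; apply: eq_bigr => i _; rewrite mxE mulrDr. Qed.

Lemma dotZ a t x : dot a (t *: x) = t * dot a x.
Proof. by rewrite /dot mulr_sumr; apply: eq_bigr => i _; rewrite mxE mulrCA. Qed.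

Lemma dot0 a : dot a 0 = 0.
Proof. by rewrite -(scale0r 0) dotZ mul0r. Qed.

Lemma dotB a x y : dot a (x - y) = dot a x - dot a y.
Proof. by rewrite -scaleN1r dotD dotZ mulN1r. Qed.

Lemma dotZl t a x : dot (t *: a) x = t * dot a x.
Proof. by rewrite /dot mulr_sumr; apply: eq_bigr => i _; rewrite mxE mulrA. Qed.

Lemma dotBl a a' x : dot (a - a') x = dot a x - dot a' x.
Proof. by rewrite /dot -sumrB; apply: eq_bigr => i _; rewrite !mxE mulrBl. Qed.

Lemma dot_delta a j : dot a (delta_mx 0 j) = a 0 j.
Proof.
rewrite /dot (bigD1 j)//= mxE !eqxx mulr1 big1 ?addr0// => i /negPf ij.
by rewrite mxE ij andbF mulr0.
Qed.

Lemma dot_gt0 a x : (forall i, 0 < a 0 i) -> (forall i, 0 < x 0 i) -> 0 < dot a x.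
Proof.
move=> a0 x0; rewrite /dot big_ord_recl ltr_pwDl ?mulr_gt0// sumr_ge0// => i _.
by rewrite mulr_ge0 ?ltW.
Qed.

Lemma dot_continuous a : continuous (dot a).
Proof.
move=> x; apply: (@cvg_big R^o 'I_n.+1 _ 0 xpredT (@add_continuous R^o) _ (nbhs x)
  (index_enum _) (fun i y => a 0 i * y 0 i) (fun i => a 0 i * x 0 i)) => i _.
apply: (@cvgM R _ (nbhs x)); first exact: cvg_cst.
exact: (@coord_continuous R 1 n.+1 0 i x).
Qed.

Lemma is_linear_dot a : linear (dot a : 'rV[R]_n.+1 -> R^o).
Proof. by move=> t x y; rewrite dotD dotZ. Qed.

HB.instance Definition _ a :=
  GRing.isLinear.Build R 'rV[R]_n.+1 R^o *:%R (dot a) (is_linear_dot a).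

Lemma dim_dot_ker a x : dot a x != 0 ->
  \dim (lker (linfun (dot a : 'rV[R]_n.+1 -> R^o))) = n.
Proof.
move=> ax; set f := linfun _.
have := limg_ker_dim f fullv; rewrite capfv dimvf /dim /= mul1n.
suff -> : \dim (limg f) = 1%N by rewrite addn1 => -[].
apply/eqP; rewrite eqn_leq lt0n dimv_eq0; apply/andP; split.
  by apply: leq_trans (dimvS (subvf _)) _; rewrite dimvf.
apply: contra ax => /eqP f0; have : f x \in limg f by rewrite memv_img ?memvf.
by rewrite f0 memv0 lfunE.
Qed.

Lemma coord_le_norm x i : `|x 0 i| <= `|x|.
Proof.
rewrite [leRHS]/Num.norm /= mx_normrE; apply/bigmax_geP; right => /=.
by exists (0, i).
Qed.

Lemma norm_le_coord x (M : R) : 0 <= M -> (forall i, `|x 0 i| <= M) -> `|x| <= M.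
Proof.
move=> M0 xM; rewrite [leLHS]/Num.norm /= mx_normrE.
by apply/bigmax_leP; split=> // -[i j] _ /=; rewrite (ord1 i).
Qed.

(* The moment curve leaves every hyperplane through the origin. *)
Lemma generic_positive (T : finType) (w : T -> 'rV[R]_n.+1) :
  exists2 u : 'rV[R]_n.+1, (forall j, 0 < u 0 j) & forall t, dot (w t) u = 0 -> w t = 0.
Proof.
pose p t : {poly R} := \poly_(j < n.+1) w t 0 (inord j).
have pE t s : (p t).[s] = dot (w t) (\row_j s ^+ j).
  by rewrite horner_poly; apply: eq_bigr => j _; rewrite mxE inord_val.
have p0 t : p t = 0 -> w t = 0.
  move=> pt; apply/rowP => j; rewrite mxE.
  by have := coef_poly n.+1 (fun j => w t 0 (inord j)) j;
    rewrite -/(p t) pt coef0 ltn_ord inord_val.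
pose q := \prod_(t | w t != 0) p t.
have q0 : q != 0.
  by apply/prodf_neq0 => t; apply: contra => /eqP/p0 ->.
(* The nonzero [q] has fewer than [size q] roots, so one of the integers 1 to [size q] is not a
   root. *)
pose rs : seq R := [seq i.+1%:R | i <- iota 0 (size q)].
have : ~~ all (root q) rs.
  apply/negP => h; have := max_poly_roots q0 h.
  rewrite size_map size_iota ltnn map_inj_uniq ?iota_uniq => [/(_ isT)//|i j].
  by move/mulrIn => /(_ (oner_neq0 _))[].
move=> /allPn[_ /mapP[i _ ->] qi].
exists (\row_j i.+1%:R ^+ j) => [j|t]; first by rewrite mxE exprn_gt0// ltr0n.
rewrite -pE => pt; apply/eqP; apply: contraR qi => wt.
by rewrite /q (bigD1 t)//= rootM /root pt eqxx.
Qed.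

Lemma polyhedronP C : polyhedron C -> exists m (a : 'I_m -> 'rV[R]_n.+1) (b : 'I_m -> R),
  C = [set x | forall i, b i <= dot (a i) x].
Proof.
move=> [m [H [/boolp.choice[a /boolp.choice[b hH]] ->]]]; exists m, a, b.
apply/seteqP; split=> x /= h i => [|_]; first by have := h i I; rewrite (hH i).2.
by rewrite (hH i).2; exact: h.
Qed.

Lemma closed_dot_ge a (b : R) : closed [set x | b <= dot a x].
Proof.
apply: (@preimage_closed _ _ (dot a) [set y | b <= y]); last exact: closed_ge.
by move=> x _; exact: dot_continuous.
Qed.

Lemma closed_dot_eq a (b : R) : closed [set x | dot a x = b].
Proof.
apply: (@preimage_closed _ _ (dot a) [set y | y = b]); last exact: closed_eq.
by move=> x _; exact: dot_continuous.
Qed.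

Lemma polyhedron_closed C : polyhedron C -> closed C.
Proof.
move=> /polyhedronP[m [a [b ->]]].
rewrite (_ : [set _ | _] = \bigcap_(i in setT) [set x | b i <= dot (a i) x]).
  by apply: closed_bigI => i _; exact: closed_dot_ge.
by apply/seteqP; split=> x h i; [move=> _; exact: h|exact: (h i I)].
Qed.

(** * Faces of a polyhedron in the orthant that avoids 0 and contains the far part of each axis *)

Section UpwardUnboundedPolyhedron.
Context {C : set 'rV[R]_n.+1} {N : nat}.
Context (C_poly : polyhedron C) (C_ge0 : forall x, C x -> forall i, 0 <= x 0 i).
Context (C_not0 : ~ C 0).
Context (C_axes : forall M j, (N <= M)%N -> C (M%:R *: delta_mx 0 j)).

Lemma upward_halfspaces : exists m (a : 'I_m -> 'rV[R]_n.+1) (b : 'I_m -> R),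
  [/\ C = [set x | forall i, b i <= dot (a i) x],
      forall i j, 0 <= a i 0 j,
      forall i j, 0 < b i -> 0 < a i 0 j
    & exists i, 0 < b i].
Proof.
have [m [a [b CE]]] := polyhedronP _ C_poly; exists m, a, b.
have axes M i j : (N <= M)%N -> b i <= M%:R * a i 0 j.
  by move=> NM; rewrite -dot_delta -dotZ; have := C_axes M j NM; rewrite CE; apply.
have a_ge0 i j : 0 <= a i 0 j.
  rewrite leNgt; apply/negP => aij.
  (* Far enough along axis [j], a negative coefficient takes the form below [- |b i|], violating the
     constraint. *)
  pose K := Num.bound (`|b i| / - a i 0 j).
  have := axes (N + K)%N i j (leq_addr _ _).
  apply/negP; rewrite -ltNge natrD mulrDl.
  apply: (@le_lt_trans _ _ (K%:R * a i 0 j)).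
    by rewrite gerDr mulr_ge0_le0// ltW.
  apply: (@lt_le_trans _ _ (- `|b i|)); last by rewrite lerNl -normrN ler_norm.
  rewrite ltrNr -mulrN -ltr_pdivrMr ?oppr_gt0//.
  by rewrite archi_boundP// divr_ge0// oppr_ge0 ltW.
split=> //.
  move=> i j bi; rewrite lt_neqAle a_ge0 andbT eq_sym; apply/negP => /eqP aij.
  by have := axes N i j (leqnn _); rewrite aij mulr0 leNgt bi.
apply: contrapT => nb; apply: C_not0; rewrite CE => i /=; rewrite dot0 leNgt.
by apply/negP => bi; apply: nb; exists i.
Qed.

(** If all coordinates were below [b i / S], with [S] the coefficient sum of a constraint with
    [b i > 0], that constraint would fail. *)
Lemma bounded_away : exists2 e : R, 0 < e & forall x, C x -> exists i, e <= x 0 i.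
Proof.
have [m [a [b [CE a_ge0 a_gt0 [i bi]]]]] := upward_halfspaces.
pose S := \sum_j a i 0 j.
have S0 : 0 < S.
  by rewrite /S big_ord_recl ltr_pwDl ?a_gt0// sumr_ge0.
exists (b i / S); first by rewrite divr_gt0.
move=> x; rewrite CE => /(_ i) bx; apply/existsP; apply: contraLR bx.
rewrite negb_exists => /forallP small; rewrite -ltNge.
rewrite -[ltRHS](divfK (lt0r_neq0 S0)) /S mulr_sumr /dot; apply: ltr_sum => [|j _].
  by apply/hasP; exists ord0; rewrite ?mem_index_enum.
by rewrite mulrC ltr_pM2r ?a_gt0// ltNge.
Qed.

Lemma unbounded : ~ compact C.
Proof.
move=> /compact_bounded[M [_ hM]].
pose B := Num.bound (`|M| + 1); pose K := (N + B)%N.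
have CK : C (K%:R *: delta_mx 0 ord0) by apply: C_axes; exact: leq_addr.
have := hM (`|M| + 1) (le_lt_trans (ler_norm M) _) _ CK.
rewrite ltrDl => /(_ ltr01); apply/negP; rewrite -ltNge.
apply: (@lt_le_trans _ _ (K%:R : R)).
  apply: (@lt_le_trans _ _ (B%:R : R)).
    by rewrite archi_boundP// addr_ge0.
  by rewrite ler_nat leq_addl.
apply: le_trans (coord_le_norm _ ord0).
by rewrite !mxE !eqxx mulr1 normr_nat.
Qed.

Lemma mdc_upward : is_mdc C n.
Proof.
have [m [a [b [CE a_ge0 a_gt0 [i1 bi1]]]]] := upward_halfspaces.
(* For [b i > 0] the constraint becomes [1 <= dot (c i) x]. The generic [u] takes equal values only
   on equal [c i]. *)
pose c i := (b i)^-1 *: a i.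
have [u u0 ugen] := generic_positive _ (fun ij : 'I_m * 'I_m => c ij.1 - c ij.2).
have au0 i : 0 < b i -> 0 < dot (a i) u.
  by move=> bi; apply: dot_gt0 => // j; exact: a_gt0.
(* The least [dot (c i) u] belongs to the constraint satisfied last along the ray of [u], so [x0] is
   the point where the ray enters [C]. *)
case: (@arg_minP _ _ _ i1 (fun i => 0 < b i) (fun i => dot (c i) u) bi1) => i0 bi0 hmin.
pose t := dot (c i0) u.
have t0 : 0 < t by rewrite /t dotZl mulr_gt0 ?invr_gt0// au0.
pose x0 := t^-1 *: u.
have ax0 : dot (a i0) x0 = b i0.
  by rewrite dotZ /t dotZl invfM invrK divfK// gt_eqF// au0.
have x0_ge i : b i <= dot (a i) x0.
  have [bi|bi] := ltP 0 (b i); last first.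
    apply: le_trans bi _; rewrite /dot sumr_ge0// => j _.
    by rewrite mulr_ge0// mxE mulr_ge0 ?ltW// invr_gt0.
  have h : t * b i <= dot (a i) u by rewrite -ler_pdivlMr// mulrC -dotZl; exact: hmin.
  by rewrite dotZ mulrC ler_pdivlMr// mulrC.
have cu l : 0 < b l -> dot (a l) x0 = b l -> dot (c l) u = t.
  move=> bl al; have ut : u = t *: x0 by rewrite scalerA divff ?scale1r// gt_eqF.
  by rewrite /c dotZl ut dotZ al mulrCA mulVf ?mulr1// gt_eqF.
(* A constraint tight at [x0] has [c i = c i0] if [b i > 0], and otherwise [a i = 0], since [x0] is
   positive. So directions along the facet preserve every tight constraint. *)
have x0_eq w i : dot (a i0) w = 0 -> dot (a i) x0 = b i -> dot (a i) w = 0.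
  move=> aw; have [bi|bi] := ltP 0 (b i) => ax.
    have cc : c i = c i0.
      apply/eqP; rewrite -subr_eq0; apply/eqP.
      by apply: (ugen (i, i0)); rewrite dotBl !cu ?subrr.
    have : dot (c i) w = 0 by rewrite cc dotZl aw mulr0.
    by rewrite dotZl => /eqP; rewrite mulf_eq0 invr_eq0 gt_eqF// => /eqP.
  have a0 : a i = 0.
    apply/rowP => j; rewrite mxE; apply/eqP; rewrite eq_le a_ge0 andbT leNgt.
    apply/negP => aij; have : 0 < dot (a i) x0.
      rewrite /dot (bigD1 j)//= ltr_pwDl ?mulr_gt0// ?mxE ?mulr_gt0 ?invr_gt0//.
      by rewrite sumr_ge0// => l _; rewrite mulr_ge0// mxE mulr_ge0 ?ltW ?invr_gt0.
    by rewrite ax ltNge bi.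
  by rewrite a0 /dot big1// => j _; rewrite mxE mul0r.
clearbody x0; split.
  exists [set x | C x /\ dot (a i0) x = b i0]; split.
  - exists (a i0), (b i0); split=> // x; rewrite CE; exact.
  - apply: bounded_closed_compact.
      (* On the face each [a i0 0 j * x 0 j] is at most [b i0]; the sum over [j] bounds all
         coordinates at once. *)
      pose M := \sum_j b i0 / a i0 0 j.
      have M_ge0 : 0 <= M by apply: sumr_ge0 => j _; rewrite divr_ge0 // ltW.
      exists M; split=> [|M' MM' x [Cx ax]]; first exact: num_real.
      apply: norm_le_coord => [|j]; first by rewrite (le_trans M_ge0) ?ltW.
      apply: le_trans (ltW MM'); rewrite ger0_norm; last exact: C_ge0.
      apply: (@le_trans _ _ (b i0 / a i0 0 j)).
        rewrite ler_pdivlMr ?a_gt0// mulrC -ax /dot (bigD1 j)//= lerDl sumr_ge0// => l _.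
        by rewrite mulr_ge0//; exact: C_ge0.
      by rewrite /M (bigD1 j)//= lerDl sumr_ge0// => l _; rewrite divr_ge0// ltW.
    apply: closedI; first exact: polyhedron_closed.
    exact: closed_dot_eq.
  exists x0, (lker (linfun (dot (a i0) : 'rV[R]_n.+1 -> R^o))); split.
    by apply: (@dim_dot_ker _ x0); rewrite ax0 gt_eqF.
  have kerE w : [set` lker (linfun (dot (a i0) : 'rV[R]_n.+1 -> R^o))] w <-> dot (a i0) w = 0.
    by rewrite /= memv_ker lfunE; split=> /eqP.
  apply/seteqP; split.
    apply: smallest_sub => /=.
      move=> _ _ s [y /kerE ay <-] [z /kerE az <-] /=.
      exists ((1 - s) *: y + s *: z); first by apply/kerE; rewrite dotD !dotZ ay az !mulr0 addr0.
      by rewrite !scalerDr addrACA -scalerDl subrK scale1r.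
    move=> x [_ ax]; exists (x - x0); last by rewrite subrKC.
    by apply/kerE; rewrite dotB ax ax0 subrr.
  (* Conversely, [x0 + w] lies on the line through [x0] and [x0 + e *: w], two points of the
     face. *)
  move=> _ [w /kerE aw <-].
  have [i|i|e e0 he] := @small_step _ (fun i => dot (a i) x0 - b i) (fun i => dot (a i) w).
  - by rewrite subr_ge0.
  - by move=> /eqP; rewrite subr_eq0 => /eqP; exact: x0_eq.
  have Cx0 : C x0 by rewrite CE.
  have Cxe : C (x0 + e *: w).
    by rewrite CE => i; rewrite dotD (dotZ _ e) -subr_ge0 addrAC.
  move=> D [Daff FD]; have -> : x0 + w = (1 - e^-1) *: x0 + e^-1 *: (x0 + e *: w).
    by rewrite scalerDr scalerA mulVf ?gt_eqF// scale1r addrA -scalerDl subrK scale1r.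
  apply: Daff; apply: FD; split=> //.
  by rewrite dotD (dotZ _ e) aw mulr0 addr0.
move=> F d [a' [b' [Ca' FE]]] Fc [y [U [dU aff]]].
rewrite leqNgt; apply/negP => nd.
(* A face of larger dimension has the whole space as affine hull, so its form is constant and the
   face is [C], which is not compact. *)
have UT : U = fullv.
  by apply/eqP; rewrite eqEdim subvf dU dimvf /dim /= mul1n.
have a'b' x : dot a' x = b'.
  have : (smallest is_affine F) x.
    by rewrite aff; exists (x - y); rewrite ?subrKC//= UT memvf.
  apply: (smallest_sub (X := [set x | dot a' x = b'])).
    move=> x1 x2 s /= h1 h2; by rewrite dotD !dotZ h1 h2 -mulrDl subrK mul1r.
  by rewrite FE => z [].
apply: unbounded; suff -> : C = F by [].
by rewrite FE; apply/seteqP; split=> z; [split|case].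
Qed.

End UpwardUnboundedPolyhedron.

End Geometry.

(** * Exponents of polynomial growth *)

Section GrowthRate.
Context {R : realType}.

Lemma powR_unbounded (c : R) {d : R} (J : nat) : 0 < d ->
  exists j, [/\ (0 < j)%N, (J <= j)%N & c < j%:R `^ d].
Proof.
move=> d0; pose x := `|c| + 1; pose y := x `^ d^-1.
have x0 : 0 < x by rewrite ltr_wpDl.
have yd : y `^ d = x by rewrite -powRrM mulVf ?powRr1 ?gt_eqF// ltW.
pose B := Num.bound y; exists (J + B).+1; split=> //; first by rewrite leqW ?leq_addr.
apply: (@lt_le_trans _ _ x); first by rewrite (le_lt_trans (ler_norm c)) ?ltrDl.
rewrite -yd; apply: ge0_ler_powR; rewrite ?nnegrE ?powR_ge0 ?ltW//.
apply: (@lt_le_trans _ _ (B%:R : R)); first by rewrite archi_boundP// powR_ge0.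
by rewrite ler_nat leqW// leq_addl.
Qed.

Lemma bigO_powRP (u : nat -> nat) (s : R) :
  (fun j => (u j)%:R : R^o) =O_\oo (fun j => j%:R `^ s : R^o) <->
  exists c J, forall j, (J <= j)%N -> (u j)%:R <= c * j%:R `^ s.
Proof.
split=> [/eqO_exP[c c0 [J _ hJ]]|[c [J h]]].
  exists c, J => j Jj; have := hJ j Jj.
  by rewrite /= normr_nat ger0_norm ?powR_ge0.
apply/eqO_exP; exists (`|c| + 1); first by rewrite ltr_wpDl.
exists J => // j Jj /=; rewrite normr_nat (ger0_norm (powR_ge0 _ _)).
apply: le_trans (h j Jj) _; rewrite ler_wpM2r ?powR_ge0//.
by rewrite (le_trans (ler_norm c)) ?lerDl.
Qed.

Lemma bigO_exponent_ge1 (u : nat -> nat) (s : R) : (forall j, (0 < j)%N -> (0 < u j)%N) ->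
  (fun j => (u j)%:R : R^o) =O_\oo (fun j => j%:R `^ (s - 1) : R^o) -> 1 <= s.
Proof.
move=> u0 /bigO_powRP[c [J h]]; rewrite leNgt; apply/negP; rewrite -subr_gt0 => s1.
have [j [j0 Jj cj]] := powR_unbounded c J s1.
have := h j Jj; apply/negP; rewrite -ltNge.
apply: (@lt_le_trans _ _ 1); last by rewrite ler1n u0.
have jR : 0 < j%:R :> R by rewrite ltr0n.
by rewrite -opprB powRN ltr_pdivrMr ?mul1r// powR_gt0.
Qed.

(** Summing a bound [c' * j^(s-1)] over [j < q * t] gives at most [c' * (q * t)^s], hence
    [t^n <= B * t^s] for all [t > 0], which fails for large [t] if [s < n]. *)
Lemma bigO_exponent_ge (u : nat -> nat) (n q L : nat) (s : R) :
  (0 < q)%N -> 1 <= s ->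
  (forall t, (0 < t)%N -> (t ^ n <= L * (1 + \sum_(1 <= j < q * t) u j))%N) ->
  (fun j => (u j)%:R : R^o) =O_\oo (fun j => j%:R `^ (s - 1) : R^o) -> n%:R <= s.
Proof.
move=> q0 s1 hu /bigO_powRP[c [J h]]; rewrite leNgt; apply/negP; rewrite -subr_gt0 => sn.
(* Adding the first [J] values to the constant makes the bound hold from [j = 1] on. *)
pose A := (\sum_(i < J) u i)%N; pose c' := `|c| + A%:R.
have c'0 : 0 <= c' by rewrite addr_ge0.
have s10 : 0 <= s - 1 by rewrite subr_ge0.
have hc' j : (0 < j)%N -> (u j)%:R <= c' * j%:R `^ (s - 1).
  move=> j0; have jp : 1 <= j%:R `^ (s - 1) :> R.
    by rewrite -[leLHS](powRr0 (j%:R : R)); apply: ler_powR; rewrite ?ler1n.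
  have [Jj|jJ] := leqP J j.
    apply: le_trans (h j Jj) _; rewrite ler_wpM2r ?powR_ge0//.
    by rewrite (le_trans (ler_norm c)) ?lerDl.
  apply: (@le_trans _ _ (A%:R : R)).
    by rewrite ler_nat /A (bigD1 (Ordinal jJ))//= leq_addr.
  apply: (@le_trans _ _ c'); first by rewrite lerDr.
  by rewrite ler_peMr.
pose B : R := L%:R * (1 + c' * q%:R `^ s).
have s0 : 0 <= s by rewrite (le_trans _ s1).
have [t [t0 _ Bt]] := powR_unbounded B 0 sn.
have t1 : 1 <= t%:R `^ s :> R.
  by rewrite -[leLHS](powRr0 (t%:R : R)); apply: ler_powR; rewrite ?ler1n.
have tR : 0 < t%:R :> R by rewrite ltr0n.
have qtR : 0 < (q * t)%:R :> R by rewrite ltr0n muln_gt0 q0.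
have sumle : (\sum_(1 <= j < q * t) u j)%:R <= c' * (q * t)%:R `^ s.
  rewrite natr_sum.
  apply: (@le_trans _ _ (\sum_(1 <= j < q * t) c' * (q * t)%:R `^ (s - 1))).
    rewrite big_nat [leRHS]big_nat; apply: ler_sum => j /andP[j0 jqt].
    apply: le_trans (hc' j j0) _; rewrite ler_wpM2l// ge0_ler_powR ?nnegrE//.
    by rewrite ler_nat ltnW.
  rewrite sumr_const_nat -[leLHS]mulr_natr -mulrA ler_wpM2l//.
  apply: (@le_trans _ _ ((q * t)%:R `^ (s - 1) * (q * t)%:R)).
    by rewrite ler_wpM2l ?powR_ge0// ler_nat leq_subr.
  rewrite -{2}[(q * t)%:R]powRr1 ?ler0n// -powRD ?subrK//.
  by apply/implyP => _; rewrite gt_eqF.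
have := hu t t0; apply/negP; rewrite -ltnNge -(ltr_nat R) natrM natrD natrX.
rewrite -powR_mulrn ?ler0n//.
apply: (@le_lt_trans _ _ (B * t%:R `^ s)).
  rewrite /B -mulrA ler_wpM2l ?ler0n// mulrDl lerD ?mul1r//.
  by apply: le_trans sumle _; rewrite natrM powRM// mulrA.
have -> : n%:R = n%:R - s + s :> R by rewrite subrK.
rewrite powRD; last by apply/implyP => _; rewrite gt_eqF.
by rewrite ltr_pM2r// powR_gt0.
Qed.

End GrowthRate.

(** * Primary ideals and powers of the variables *)

Section PrimaryFamilies.
Context {k : fieldType} {n : nat}.
Local Notation A := {mpoly k[n]}.

Lemma max_homog_ideal_coef0 (f : A) : max_homog_ideal k n f -> f@_0%MM = 0.
Proof.
move: f; apply: ideal_gen_sub => [|_ [i _ <-]] /=; last first.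
  rewrite mcoeffX; case: eqP => // /mnmP/(_ i).
  by rewrite mnm1E eqxx mnm0E.
split=> [|f g f0 g0|a f f0] /=; first exact: mcoeff0.
  by rewrite mcoeffD f0 g0 addr0.
by rewrite rmorphM /= f0 mulr0.
Qed.

Lemma primary_coef0 {I : set A} f : primary_to (max_homog_ideal k n) I -> I f -> f@_0%MM = 0.
Proof. by move=> [_ rI] If; apply: max_homog_ideal_coef0; rewrite -rI; exists 1%N. Qed.

Lemma primary_powers {I : set A} : primary_to (max_homog_ideal k n) I ->
  exists N, forall i : 'I_n, I ('X_i ^+ N).
Proof.
move=> [[[_ _ IM] _ _] rI].
have /boolp.choice[e he] (i : 'I_n) : exists j, I ('X_i ^+ j).
  have : max_homog_ideal k n 'X_i by apply: sub_ideal_gen; exists i.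
  by rewrite -rI.
(* The sum of the exponents serves all variables at once. *)
exists (\sum_i e i)%N => i; rewrite (bigD1 i)//= addnC exprD.
exact: IM.
Qed.

Lemma graded_powers {I : nat -> set A} {N} (i : 'I_n) : graded_family I ->
  I 1%N ('X_i ^+ N) -> forall j, (0 < j)%N -> I j ('X_i ^+ (N * j)).
Proof.
move=> [_ II] I1; elim=> // -[|j] IH _; first by rewrite muln1.
by rewrite mulnS exprD; apply: (II 1%N j.+1) => //; apply: ideal_mulP => //; exact: IH.
Qed.

End PrimaryFamilies.

(** * The limiting body and the two invariants *)

Section LimitingBody.
Context {R : realType} {k : fieldType} {n : nat}.
Local Notation A := {mpoly k[n.+1]}.
Local Notation "x %:F" := (tofrac x).
Context {I : nat -> set A} {le : rel 'rV[int]_n.+1} {v : {fraction A} -> 'rV[int]_n.+1}.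
Context (I_graded : graded_family I).
Context (I_primary : forall j, (0 < j)%N -> primary_to (max_homog_ideal k n.+1) (I j)).
Context (le_order : group_total_order le) (v_val : is_valuation le v).
Context (v_mon : respects_monomials v).

Lemma convex_dot_ge (a : 'rV[R]_n.+1) (b : R) : convex_set [set x | b <= dot a x].
Proof.
move=> x y l; rewrite !inE /= => bx by_.
change (b <= dot a (l%:num *: (x : 'rV_n.+1) + (1 - l%:num) *: (y : 'rV_n.+1))).
rewrite dotD !dotZ.
have -> : b = l%:num * b + (1 - l%:num) * b by rewrite -mulrDl addrC subrK mul1r.
by rewrite lerD// ler_wpM2l ?subr_ge0.
Qed.

Lemma limiting_body_val {j f} : (0 < j)%N -> I j f -> f != 0 ->
  limiting_body R v I (j%:R^-1 *: toR R (v f%:F)).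
Proof.
move=> j0 If f0; exists j => //; exists (toR R (v f%:F)) => //.
by apply: sub_gen_smallest; exists (v f%:F) => //; exists f.
Qed.

(* [m] is nonzero since elements of m-primary ideals have no constant term. *)
Lemma limiting_body_sub (a : 'rV[R]_n.+1) (b : R) :
  (forall m : 'X_{1..n.+1}, m != 0%MM -> b <= \sum_i a 0 i * (m i)%:R) ->
  forall x, limiting_body R v I x -> exists2 j, (0 < j)%N & b <= j%:R * dot a x.
Proof.
move=> hm _ [j j0 [y hy <-]]; exists j => //.
rewrite dotZ mulVKf ?pnatr_eq0 -?lt0n//.
move: y hy; apply: smallest_sub; first exact: convex_dot_ge.
move=> _ [_ [f [If f0] <-] <-] /=.
have [m mf ->] := valuation_mem_msupp le_order v_val v_mon f f0.
have m0 : m != 0%MM.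
  apply: contraTneq mf => ->.
  by rewrite mcoeff_msupp negbK (primary_coef0 _ (I_primary _ j0) If).
have := hm m m0; rewrite /dot; congr (_ <= _).
by apply: eq_bigr => i _; rewrite !mxE.
Qed.

Lemma limiting_body_ge0 x : limiting_body R v I x -> forall i, 0 <= x 0 i.
Proof.
move=> Cx i; have [] := @limiting_body_sub (delta_mx 0 i) 0 _ x Cx.
  by move=> m _; rewrite sumr_ge0// => j _; rewrite mxE mulr_ge0// ler0n.
move=> j j0; have -> : dot (delta_mx 0 i) x = x 0 i.
  rewrite -(dot_delta x i) /dot; apply: eq_bigr => l _; exact: mulrC.
by rewrite pmulr_rge0// ltr0n.
Qed.

(** Use the form with all coefficients 1: a nonzero exponent has degree at least 1. *)
Lemma limiting_body_not0 : ~ limiting_body R v I 0.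
Proof.
move=> C0; have [] := @limiting_body_sub (const_mx 1) 1 _ 0 C0; last first.
  by move=> j _; rewrite dot0 mulr0 ler10.
move=> m m0; under eq_bigr do rewrite mxE mul1r.
by rewrite -natr_sum ler1n -mdegE lt0n mdeg_eq0.
Qed.

Lemma limiting_body_axes {N} : (forall i : 'I_n.+1, I 1%N ('X_i ^+ N)) ->
  forall M i, (N <= M)%N -> limiting_body R v I (M%:R *: delta_mx 0 i).
Proof.
move=> IX M i NM.
have X0 : ('X_[U_(i) *+ M] : A) != 0.
  by rewrite -mleadc_eq0 mleadXm mcoeffX eqxx oner_neq0.
have IM : I 1%N 'X_[U_(i) *+ M].
  apply: (ideal_monomial_ge i _ (IX i)); first exact: I_graded.1.
  by rewrite mulmnE mnm1E eqxx mul1n.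
have := limiting_body_val (ltn0Sn 0) IM X0; congr limiting_body.
apply/rowP => j; rewrite v_mon !mxE invr1 mul1r mulmnE mnm1E /= eq_sym.
by case: eqP; rewrite ?mulr1 ?mulr0 ?mul1n ?mul0n.
Qed.

Lemma mdc_and_ell_star : polyhedron (limiting_body R v I) ->
  is_mdc (NO_body R v I) n /\ is_ell_star I (n.+1%:R : R).
Proof.
move=> C_poly; have [N IX] := primary_powers (I_primary 1%N (ltn0Sn 0)).
have axes := limiting_body_axes IX.
split.
  (* A polyhedron is closed, so the Newton-Okounkov body is the limiting body itself. *)
  rewrite /NO_body -(closure_id _).1; last exact: polyhedron_closed.
  exact: (mdc_upward C_poly limiting_body_ge0 limiting_body_not0 axes).
have Ij_ideal j : (0 < j)%N -> is_ideal (I j) by exact: I_graded.1.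
have IXj j i : (0 < j)%N -> I j ('X_i ^+ (N * j)) by apply: graded_powers.
have gens j : (0 < j)%N -> gen_by (I j) (n.+1 + (N * j) ^ n).
  by move=> j0; apply: gen_by_box => [|i]; [exact: Ij_ideal|exact: IXj].
have X0 m : ('X_[m] : A) != 0 by rewrite -mleadc_eq0 mleadXm mcoeffX eqxx oner_neq0.
split.
  apply/bigO_powRP; exists (n.+1%:R + (N ^ n)%:R), 1%N => j j0.
  have -> : n.+1%:R - 1 = n%:R :> R by rewrite -natr1 addrK.
  rewrite powR_mulrn// -natrX -natrD -natrM ler_nat.
  apply: leq_trans (gen_by_mu (gens j j0)).2 _.
  by rewrite mulnDl expnMn leq_add2r -[leqLHS]muln1 leq_mul2l expn_gt0 j0 orbT.
move=> s hs.
have s1 : 1 <= s.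
  apply: (bigO_exponent_ge1 _ _ _ hs) => j j0; apply: (mu_gt0 (gens j j0)).
  by exists ('X_ord0 ^+ (N * j)); [exact: IXj|rewrite mpolyXn].
have [e e0 he] := bounded_away C_poly limiting_body_not0 axes.
(* Chosen so that exponents below [t], divided by [q * t], fall below [1 / q <= e]. *)
pose q := (Num.bound e^-1).+1.
have qe : 1 <= q%:R * e.
  rewrite -ler_pdivrMr// div1r ltW// (lt_le_trans (archi_boundP _))//.
    by rewrite invr_ge0 ltW.
  by rewrite ler_nat.
apply: (@bigO_exponent_ge _ _ n.+1 q (N ^ n.+1) _ _ s1 _ hs) => // t t0.
(* Otherwise [I (q * t)] contains a nonzero [f] with all exponents below [t], and its scaled value
   is a point of the body with every coordinate below [e]. *)
rewrite leqNgt; apply/negP => small.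
have qt0 : (0 < q * t)%N by rewrite muln_gt0.
have qtE : (q * t = (q * t).-1.+1)%N by rewrite prednK.
have := @spanned_mod_graded _ _ I N (q * t).-1 I_graded IX (fun j j0 => (gen_by_mu (gens j j0)).1).
rewrite -qtE => /spanned_mod_box/(_ (Ij_ideal _ qt0) small)[f [If f0 fsmall]].
have [i] := he _ (limiting_body_val qt0 If f0).
have [m mf ->] := valuation_mem_msupp le_order v_val v_mon f f0.
apply/negP; rewrite -ltNge !mxE ltr_pdivrMl ?ltr0n//.
apply: (@lt_le_trans _ _ (t%:R : R)); first by rewrite ltr_nat fsmall.
by rewrite natrM mulrAC -[leLHS]mul1r ler_wpM2r// ler0n.
Qed.

End LimitingBody.

Theorem theorem4p22 (R : realType) (k : fieldType) (n : nat)
    (I : nat -> set {mpoly k[n]})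
    (le : rel 'rV[int]_n) (v : {fraction {mpoly k[n]}} -> 'rV[int]_n) :
  (0 < n)%N ->
  graded_family I ->
  (forall j, (0 < j)%N -> primary_to (max_homog_ideal k n) (I j)) ->
  (forall j, (0 < j)%N -> homogeneous_ideal (I j)) ->
  group_total_order le ->
  good_valuation R le v ->
  respects_monomials v ->
  polyhedron (limiting_body R v I) ->
  exists d : nat,
    [/\ is_mdc (NO_body R v I) d,
        is_ell_star I ((d + 1)%:R : R)
      & krull_dim {mpoly k[n]} (d + 1)%N].
Proof.
(* The number of variables is now [n.+1], and the witness [d] is [n]. *)
case: n I le v => // n I le v _ Igr Iprim _ leo [vval _ _ _ _] vmon Cpoly.
have [mdcn elln] := mdc_and_ell_star Igr Iprim leo vval vmon Cpoly.
by exists n; rewrite addn1; split=> //; exact: krull_dim_mpoly.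
Qed.
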